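(* Let $a=(a_1,a_2,a_1,a_2,\dots)\in(0,1)^{\mathbb N}$ be the periodic sequence alternating between $a_1$ and $a_2$, where $a_1<\frac13$ and $a_2>\frac13$. If either $$a_1\le\frac1{35}\quad\text{and}\quad a_2\le\frac{-a_1-5+\sqrt{a_1^2+34a_1+33}}{2-2a_1},$$ or $$a_1\in\left(\frac1{35},\frac{6\sqrt5-13}{11}\right)\quad\text{and}\quad a_2\le\frac{3a_1+1-4\sqrt{a_1^2+a_1}}{1-a_1},$$ then the set $C(a)-C(a)$ is a Cantorval.
   Context: $A-B=\{x-y:x\in A,\ y\in B\}$. Central Cantor set $C(a)$ for $a=(a_n)\in(0,1)^{\mathbb N}$: put $I_\emptyset=[0,1]$, $d_0=1$. Given $I_t$ of length $d_n$ for $t\in\{0,1\}^n$, remove from it the concentric open interval of length $a_{n+1}d_n$; let $I_{t\hat{}0}$, $I_{t\hat{}1}$ (indices formed by appending $0$ or $1$ to $t$) be the left and right components of what remains, of common length $d_{n+1}$. Let $C(a)=\bigcap_{n\in\mathbb N}\bigcup_{t\in\{0,1\}^n}I_t$. A gap of $E\subset\mathbb R$ is a bounded connected component of $\mathbb R\setminus E$; a component of $E$ is proper if it is not a singleton. A perfect set $E\subset\mathbb R$ is a Cantorval (M-Cantorval) if it has infinitely many gaps and both endpoints of every gap are accumulated by gaps and by proper components of $E$. *)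

(* Defs.v *)
From mathcomp Require Import all_boot all_order all_algebra.
From mathcomp Require Import all_classical all_reals all_analysis.
Import Order.TTheory GRing.Theory Num.Theory.
Import numFieldNormedType.Exports.

Set Implicit Arguments.
Unset Strict Implicit.
Unset Printing Implicit Defensive.

Local Open Scope classical_set_scope.
Local Open Scope ring_scope.

Definition set_difference (R : realType) (A B : set R) : set R :=
  [set x - y | x in A & y in B].

(* A compact interval [u, v] is encoded by the pair (u, v).  Removing from it
   the concentric open interval of length r (v - u) leaves the left child
   (b = false) and the right child (b = true). *)
Definition child (R : realType) (r : R) (b : bool) (I : R * R) : R * R :=
  let mid := (I.1 + I.2) / 2 in
  let half := r * (I.2 - I.1) / 2 in
  if b then (mid + half, I.2) else (I.1, mid - half).

(* Endpoints of I_t when t has length n.  Sequences are indexed from 0: the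
   (n+1)-st term of the sequence (a_1, a_2, ...) is a n, and the last letter of
   a word of length n.+1 has index n. *)
Fixpoint cantor_itv (R : realType) (a : nat -> R) (n : nat) (t : seq bool)
    : R * R :=
  if n is m.+1 then child (a m) (nth false t m) (cantor_itv a m t)
  else (0, 1).

Lemma cantor_itv_rcons (R : realType) (a : nat -> R) (n : nat)
    (t : n.-tuple bool) (b : bool) :
  cantor_itv a n.+1 (rcons t b) = child (a n) b (cantor_itv a n t).
Proof.
rewrite /= nth_rcons size_tuple ltnn eqxx; congr child.
suff H m : (m <= n)%N -> cantor_itv a m (rcons t b) = cantor_itv a m t.
  exact: H.
elim: m => [//|m IHm] lt_mn /=.
by rewrite nth_rcons size_tuple lt_mn IHm // ltnW.
Qed.

Definition central_cantor (R : realType) (a : nat -> R) : set R :=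
  \bigcap_(n in [set: nat]) \bigcup_(t in [set: n.-tuple bool])
    [set x | (cantor_itv a n t).1 <= x <= (cantor_itv a n t).2].

Definition alternating_seq (R : realType) (a1 a2 : R) (n : nat) : R :=
  if odd n then a2 else a1.

Definition is_component (R : realType) (E K : set R) : Prop :=
  exists2 x, E x & K = connected_component E x.

Definition is_gap (R : realType) (E G : set R) : Prop :=
  is_component (~` E) G /\ bounded_set G.

Definition is_proper_component (R : realType) (E K : set R) : Prop :=
  is_component E K /\ ~ (exists x, K = [set x]).

(* For a closed set, the members of F used below are connected and have more than one point, so
   no single one of them is contained in every neighborhood of p: having one
   member inside each neighborhood amounts to having infinitely many. *)
Definition accumulation_at (R : realType) (p : R) (F : set (set R)) : Prop :=
  forall U : set R, nbhs p U -> exists2 J, F J & J `<=` U.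

(* A gap is a nonempty bounded interval; its endpoints are inf G and sup G. *)
Definition is_cantorval (R : realType) (E : set R) : Prop :=
  [/\ perfect_set E,
      infinite_set (is_gap E) &
      forall G, is_gap E G -> forall p, p = inf G \/ p = sup G ->
        accumulation_at p (is_gap E) /\
        accumulation_at p (is_proper_component E)].

(* Main.v *)
Require Import Defs.
From mathcomp Require Import all_boot all_order all_algebra.
From mathcomp Require Import all_classical all_reals all_analysis.
From mathcomp Require Import ring lra.
Import Order.TTheory GRing.Theory Num.Theory.
Import numFieldNormedType.Exports.

(** Write [C] for the Cantor set, [E = C - C], and
      [q = (1 - a1) (1 - a2) / 4], [t1 = (1 + a1) / 2],
      [t2 = (1 - a1) (1 + a2) / 4].
    Two construction steps split [C] into four translates of [q C], by the
    vectors [b1 t1 + b2 t2] with [b1, b2] in {0, 1}; hence [E] is the union of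
    the nine copies [q E + i t1 + j t2] with [i, j] in {-1, 0, 1}
    ([difference_self_similar]).

    E contains an interval.  Discard the two extreme digits [t1 + t2] and
    [- t1 - t2].  If the remaining seven copies of [[-c, c]] cover [[-c, c]],
    then expanding a point of [[-c, c]] again and again exhibits it as a limit
    of points of the closed set [E] ([interval_in_self_similar]).  The largest
    possible [c] solves [c = t1 + q c], and the copies then cover as soon
    as the spacings [t1 - t2] and [2 t2 - t1] of the seven digits are at most
    [2 q c].  In terms of [u = (1 - a1) a2] these are two quadratic inequalities
    in [u]; solving the second one gives the bound on [a2] of the first
    alternative, and solving the first one gives the bound of the second
    alternative.  Which of the two is the stronger one depends on the sign of
    [a1 - 1/35] ([cover_conditions]).

    E is a Cantorval.  Since [a2 > 1/3], the top copy is separated from the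
    eight others by a gap, so that near its maximum [1] the set [E] coincides
    with arbitrarily small copies of itself; each copy carries a gap, and a
    proper component produced by [[-c, c]].  An endpoint of an arbitrary gap of
    [E] must be an endpoint of one of the finitely many copies of each
    sufficiently high level, and near it no other copy of that level is
    present.  So the picture at [1] is reproduced at that endpoint
    ([self_similar_cantorval]). *)

Set Implicit Arguments.
Unset Strict Implicit.

Local Open Scope classical_set_scope.
Local Open Scope ring_scope.

(** * Gaps and components of subsets of the line *)

Lemma component_realP (R : realType) (A : set R) (x y : R) :
  connected_component A x y <->
  (forall z, Num.min x y <= z <= Num.max x y -> A z).
Proof.
split=> [[C [Cx CA /connected_intervalP iC] Cy] z zxy | Axy].
  apply: CA; case: (leP x y) zxy => xy zxy; [exact: iC zxy | exact: iC zxy].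
apply: (@connected_component_max _ A `[Num.min x y, Num.max x y]%classic).
- by rewrite /= in_itv /= ge_min le_max !lexx.
- by move=> z; rewrite /= in_itv /=; exact: Axy.
- by apply/connected_intervalP; exact: interval_is_interval.
- by rewrite /= in_itv /= ge_min le_max !lexx !orbT.
Qed.

Lemma closed_avoid (R : realType) (E : set R) (p : R) :
  closed E -> ~ E p ->
  exists2 e : R, 0 < e & forall y : R, `|p - y| < e -> ~ E y.
Proof.
move=> cE nEp; have : nbhs p (~` E).
  by apply: open_nbhs_nbhs; split => //; exact: closed_openC.
move=> /nbhs_ballP[e /= e0 eE].
by exists e => // y py; apply: eE; rewrite -ball_normE.
Qed.

Lemma gap_of_itv (R : realType) (E : set R) (u v : R) :
  u < v -> E u -> E v -> (forall x, u < x < v -> ~ E x) ->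
  is_gap E `]u, v[%classic.
Proof.
move=> uv Eu Ev nE; split.
  exists ((u + v) / 2); first by apply: nE; lra.
  rewrite eqEsubset; split=> y /=; rewrite in_itv /=.
    move=> yuv; apply/component_realP => z zy; apply: nE.
    by case: (leP ((u + v) / 2) y) zy => _ /andP[? ?]; lra.
  move=> /component_realP nEy.
  apply/andP; split; rewrite ltNge; apply/negP => le.
    apply: (nEy u) => //; rewrite ge_min le_max le orbT /=.
    by apply/orP; left; lra.
  apply: (nEy v) => //; rewrite ge_min le_max le orbT andbT.
  by apply/orP; left; lra.
exists (Num.max `|u| `|v|); split; first exact: num_real.
move=> M; rewrite gt_max => /andP[uM vM] x /=.
rewrite in_itv /= => /andP[ux xv].
by move: uM vM; rewrite !ltr_norml ler_norml => /andP[? ?] /andP[? ?]; lra.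
Qed.

(** Points outside [E] on both sides confine the component of [l]; this is how
    components are located without computing them. *)
Lemma proper_component_between (R : realType) (E : set R) (u l r v : R) :
  u < l -> l < r -> r < v -> ~ E u -> ~ E v ->
  (forall x, l <= x <= r -> E x) ->
  exists2 K, is_proper_component E K & K `<=` `]u, v[.
Proof.
move=> ul lr rv nEu nEv lrE; exists (connected_component E l).
  split; first by exists l => //; apply: lrE; rewrite lexx ltW.
  move=> [x Kx]; have Kl : connected_component E l l.
    by apply: connected_component_refl; apply: lrE; rewrite lexx ltW.
  have Kr : connected_component E l r.
    apply/component_realP => z; rewrite min_l ?max_r ?(ltW lr) //.
    exact: lrE.
  by move: Kl Kr lr; rewrite Kx => -> /= ->; rewrite ltxx.
move=> y /component_realP Ey; rewrite /= in_itv /=.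
apply/andP; split; rewrite ltNge; apply/negP => le.
  by apply: nEu; apply: Ey; rewrite ge_min le_max le (ltW ul) !orbT.
apply: nEv; apply: Ey; rewrite ge_min le_max le orbT andbT.
by apply/orP; left; lra.
Qed.

(** A gap contains every point that can be joined to it outside [E].  Since the
    complement of [E] is open, the infimum of the gap cannot lie in it. *)
Lemma gap_inf (R : realType) (E G : set R) :
  closed E -> is_gap E G ->
  E (inf G) /\ exists2 r, inf G < r & forall y, inf G < y < r -> ~ E y.
Proof.
move=> cE [[x nEx GE] bG].
have [M M0 GM] := ex_strict_bound_gt0 bG.
have Gx : G x by rewrite GE; exact: connected_component_refl.
have lbG : has_lbound G.
  by exists (- M) => y /GM /=; rewrite ltr_norml => /andP[/ltW].
have hG : has_inf G by split=> //; exists x.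
have px : inf G <= x by exact: ge_inf.
have nE y : inf G < y <= x -> ~ E y.
  move=> /andP[py yx]; have e0 : 0 < y - inf G by rewrite subr_gt0.
  have [g Gg gy] := inf_adherent e0 hG.
  move: Gg; rewrite GE => /component_realP; apply.
  by rewrite ge_min le_max yx andbT; apply/orP; right; lra.
have Ep : E (inf G).
  apply: contrapT => nEp; have [e e0 eE] := closed_avoid cE nEp.
  have Gq : G (inf G - e / 2).
    rewrite {1}GE; apply/component_realP => z.
    rewrite ge_min le_max => /andP[/orP z1 /orP z2].
    have [zp|pz] := lerP z (inf G); last by apply: nE; case: z2 => ?; lra.
    apply: eE; rewrite ger0_norm; last by lra.
    by case: z1 => ?; lra.
  by have := ge_inf lbG Gq; lra.
split=> //; exists x; last by move=> y /andP[py yx]; apply: nE; rewrite py ltW.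
by rewrite lt_neqAle px andbT; apply/negP => /eqP px'; apply: nEx; rewrite -px'.
Qed.

(** * Self-similar sets with an isolated top copy *)

Definition self_similar (R : realType) (q : R) (D : seq R) (E : set R) :=
  forall x : R, E x <-> exists2 d, d \in D & E ((x - d) / q).

(** The digits at level [n] are the sums [d1 + q d2 + .. + q^(n-1) dn]; only
    their existence and finiteness matter later. *)
Lemma self_similar_iter (R : realType) (q : R) (D : seq R) (E : set R) n :
  0 < q -> self_similar q D E -> exists Dn, self_similar (q ^+ n) Dn E.
Proof.
move=> q0 ssE; elim: n => [|n [Dn ssn]].
  exists [:: 0] => x; rewrite expr0; split => [Ex|[d]].
    by exists 0; rewrite ?inE // subr0 divr1.
  by rewrite inE => /eqP ->; rewrite subr0 divr1.
have eqn x d b : (x - (d + q * b)) / q ^+ n.+1 = ((x - d) / q - b) / q ^+ n.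
  by rewrite exprS; field; rewrite gt_eqF ?exprn_gt0 // gt_eqF.
exists [seq d + q * b | d <- D, b <- Dn] => x; split.
  move=> /ssE[d dD /ssn[b bD Eb]]; exists (d + q * b); last by rewrite eqn.
  by apply/allpairsP; exists (d, b).
move=> [_ /allpairsP[[d b] /= [dD bD ->]]]; rewrite eqn => Eb.
by apply/ssE; exists d => //; apply/ssn; exists b.
Qed.

Lemma expr_eventually_lt (R : realType) (q e : R) :
  0 < q < 1 -> 0 < e -> exists n, q ^+ n < e.
Proof.
move=> /andP[q0 q1] e0.
have /cvgrPdist_lt/(_ e e0)[n _ /(_ n (leqnn n)) qn] :
    q ^+ k @[k --> \oo] --> 0.
  by apply: cvg_expr; rewrite gtr0_norm.
by exists n; move: qn; rewrite /= sub0r normrN ger0_norm // exprn_ge0 // ltW.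
Qed.

Lemma seq_below_separated (R : realType) (s : seq R) (p : R) :
  exists2 e : R, 0 < e & forall y : R, y \in s -> y < p -> y <= p - e.
Proof.
elim: s => [|z s [e e0 es]]; first by exists 1.
have [zp|pz] := ltrP z p; last first.
  exists e => // y; rewrite inE => /orP[/eqP ->|]; last exact: es.
  by rewrite ltNge pz.
exists (Num.min e (p - z)); first by rewrite lt_min e0 subr_gt0.
move=> y; rewrite inE => /orP[/eqP -> _|ys yp].
  by have : Num.min e (p - z) <= p - z; [rewrite ge_min lexx orbT|lra].
have := es y ys yp.
by have : Num.min e (p - z) <= e; [rewrite ge_min lexx|lra].
Qed.

(** Scaled copies of [E] over [[-1, 1]] that agree with [E] itself on the whole
    window they occupy, in every neighborhood of [p].  Agreement in both
    directions is what transports gaps and components, not just points. *)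
Definition small_copies_at (R : realType) (E : set R) (p : R) :=
  forall e : R, 0 < e -> exists a b : R, [/\ 0 < a,
    forall x : R, -1 <= x <= 1 -> `|a * x + b - p| < e &
    forall x : R, -1 <= x <= 1 -> (E (a * x + b) <-> E x)].

Lemma small_copiesN (R : realType) (E : set R) (p : R) :
  (forall x : R, E x -> E (- x)) ->
  small_copies_at E p -> small_copies_at E (- p).
Proof.
move=> EN cp e e0; have [a [b [a0 close copy]]] := cp e e0.
have EN2 x : E x <-> E (- x) by split=> /EN //; rewrite opprK.
have neg (x : R) : -1 <= x <= 1 -> -1 <= - x <= 1 by lra.
have eqN (x : R) : a * x + - b = - (a * - x + b) by ring.
exists a, (- b); split=> // x x1; rewrite eqN.
  by rewrite -opprD normrN; apply/close/neg.
by rewrite -EN2 (copy _ (neg _ x1)) -EN2.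
Qed.

(** One gap [(g, g')] and one interval [[l, r]] isolated by [u] and [v] suffice:
    all six points are moved by the affine maps of the copies. *)
Lemma accumulation_of_copies (R : realType) (E : set R) (p g g' u l r v : R) :
  small_copies_at E p ->
  -1 <= g -> g < g' -> g' <= 1 -> E g -> E g' ->
  (forall x : R, g < x < g' -> ~ E x) ->
  -1 <= u -> u < l -> l < r -> r < v -> v <= 1 -> ~ E u -> ~ E v ->
  (forall x : R, l <= x <= r -> E x) ->
  accumulation_at p (is_gap E) /\ accumulation_at p (is_proper_component E).
Proof.
move=> cp g1 gg' g'1 Eg Eg' nE u1 ul lr rv v1 nEu nEv lrE.
have pull (a b x y z : R) : 0 < a -> a * y + b < x < a * z + b ->
    exists2 x' : R, y < x' < z & x = a * x' + b.
  move=> a0 /andP[yx xz]; exists ((x - b) / a); last by field; rewrite gt_eqF.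
  by rewrite ltr_pdivlMr // ltr_pdivrMr //; apply/andP; split; lra.
have pullW (a b x y z : R) : 0 < a -> a * y + b <= x <= a * z + b ->
    exists2 x' : R, y <= x' <= z & x = a * x' + b.
  move=> a0 /andP[yx xz]; exists ((x - b) / a); last by field; rewrite gt_eqF.
  by rewrite ler_pdivlMr // ler_pdivrMr //; apply/andP; split; lra.
split=> U /nbhs_ballP[e /= e0 eU]; have [a [b [a0 close copy]]] := cp e e0;
  have mono (x y : R) : x < y -> a * x + b < a * y + b
    by rewrite ltrD2r ltr_pM2l.
- exists `](a * g + b), (a * g' + b)[%classic.
    apply: gap_of_itv; first exact: mono.
    + by apply/copy => //; lra.
    + by apply/copy => //; lra.
    + move=> x /pull[//|x' gx ->] /copy Ex.
      by apply: (nE x' gx); apply: Ex; lra.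
  move=> x /=; rewrite in_itv /= => /pull[//|x' gx ->].
  by apply: eU; rewrite -ball_normE /= distrC; apply: close; lra.
- have [||||||K pK Kuv] :=
    @proper_component_between _ E (a * u + b) (a * l + b)
                                  (a * r + b) (a * v + b).
  + exact: mono.
  + exact: mono.
  + exact: mono.
  + by move=> /copy Eu; apply/nEu/Eu; lra.
  + by move=> /copy Ev; apply/nEv/Ev; lra.
  + by move=> x /pullW[//|x' lx ->]; apply/copy; [lra|exact: lrE].
  exists K => // x /Kuv /=; rewrite in_itv /= => /pull[//|x' ux ->].
  by apply: eU; rewrite -ball_normE /= distrC; apply: close; lra.
Qed.

Section SelfSimilarCantorval.

Variables (R : realType) (q g c : R) (D : seq R) (E : set R).
Hypotheses (q01 : 0 < q < 1) (ssE : self_similar q D E) (closedE : closed E).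
Hypotheses (EN : forall x : R, E x -> E (- x)) (E1 : E 1).
Hypothesis (Ebnd : forall x : R, E x -> -1 <= x <= 1).
Hypotheses (topD : 1 - q \in D)
  (sepD : forall d, d \in D -> d = 1 - q \/ d + q <= g).
Hypotheses (g0 : 0 < g) (gq : g < 1 - 2 * q) (Eg : E g).
Hypotheses (c0 : 0 < c) (Ec : forall x : R, - c <= x <= c -> E x).

Let q0 : 0 < q. Proof. by case/andP: q01. Qed.

Let EN1 : E (- 1). Proof. exact: EN. Qed.

(** The map [x |-> 1 - q (1 - x)] fixes the maximum [1] and has the top digit
    [1 - q]; it sends [[-1, 1]] into [[1 - 2 q, 1]], above [g], out of reach
    of the other copies. *)
Let top_copy1 x : -1 <= x <= 1 -> (E (1 - q * (1 - x)) <-> E x).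
Proof.
move=> x1.
have xE : (1 - q * (1 - x) - (1 - q)) / q = x by field; rewrite gt_eqF.
split=> [/ssE[d dD]|Ex]; last by apply/ssE; exists (1 - q) => //; rewrite xE.
case: (sepD dD) => [->|dg]; first by rewrite xE.
move=> /Ebnd /andP[_]; rewrite ler_pdivrMr // mul1r => dq.
have : q * (1 - x) <= q * 2 by rewrite ler_pM2l //; lra.
by move: gq; lra.
Qed.

Let top_copy k x : -1 <= x <= 1 -> (E (1 - q ^+ k * (1 - x)) <-> E x).
Proof.
move=> x1; elim: k => [|k IH].
  by rewrite expr0 (_ : 1 - 1 * (1 - x) = x) //; ring.
rewrite -IH -(top_copy1 (x := 1 - q ^+ k * (1 - x))); last first.
  have h0 : 0 <= q ^+ k by rewrite exprn_ge0 // ltW.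
  have h1 : q ^+ k <= 1 by rewrite exprn_ile1 // ltW //; case/andP: q01.
  have : 0 <= q ^+ k * (1 - x) by rewrite mulr_ge0 //; lra.
  have : q ^+ k * (1 - x) <= 1 * 2 by rewrite ler_pM //; lra.
  by move=> ? ?; lra.
rewrite (_ : 1 - q ^+ k.+1 * (1 - x) =
  1 - q * (1 - (1 - q ^+ k * (1 - x)))) //.
by rewrite exprS; ring.
Qed.

Let ends_in_E Q Dn b : 0 < Q -> self_similar Q Dn E -> b \in Dn ->
  E (b + Q) /\ E (b - Q).
Proof.
move=> Q0 ssn bD; split; apply/ssn; exists b => //.
  by rewrite (_ : (b + Q - b) / Q = 1) //; field; rewrite gt_eqF.
by rewrite (_ : (b - Q - b) / Q = -1) //; field; rewrite gt_eqF.
Qed.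

Let copy_around Q b p : 0 < Q -> E ((p - b) / Q) -> b - Q <= p <= b + Q.
Proof.
move=> Q0 /Ebnd; rewrite ler_pdivlMr // ler_pdivrMr // => /andP[? ?]; lra.
Qed.

(** Take a level [n] whose copies are shorter than [r - p].  The right end of a
    copy that has a point in [(-oo, p]] is below [r] and belongs to [E], so it
    does not lie strictly between [p] and [r].  If it is [p], this determines
    the copy; the right ends below [p], being finitely many, stay at a distance
    from [p].  Hence a single copy accounts for [E] just to the left of [p]. *)
Let small_copies_right p r : E p -> p < r ->
  (forall y : R, p < y < r -> ~ E y) -> small_copies_at E p.
Proof.
move=> Ep pr nE.
have [n nr] : exists n, q ^+ n < (r - p) / 2.
  by apply: expr_eventually_lt; [exact: q01|lra].
have [Dn ssn] := self_similar_iter n q0 ssE.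
have Q0 : 0 < q ^+ n by rewrite exprn_gt0.
have Q1 : q ^+ n <= 1 by rewrite exprn_ile1 // ltW //; case/andP: q01.
set Q := q ^+ n in nr ssn Q0 Q1.
have right_end b y : b \in Dn -> E ((y - b) / Q) -> y <= p -> p <= b + Q ->
    b + Q = p.
  move=> bD /(copy_around Q0)/andP[by1 by2] yp pb.
  have [EbQ _] := ends_in_E Q0 ssn bD.
  have [->//|bp] := eqVneq (b + Q) p.
  exfalso; apply: (nE (b + Q)) => //; rewrite lt_neqAle eq_sym bp pb /=; lra.
have /ssn[b bD Eb] := Ep.
have bQp : b + Q = p.
  by apply: (right_end _ p) => //; case/andP: (copy_around Q0 Eb).
have [eps eps0 sep] := seq_below_separated [seq d + Q | d <- Dn] p.
have local y : p - eps < y <= p -> (E y <-> E ((y - b) / Q)).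
  move=> /andP[yeps yp]; split=> [/ssn[b' b'D Eb']|]; last first.
    by move=> Eb'; apply/ssn; exists b.
  suff -> : b = b' by [].
  apply: (addIr Q); rewrite bQp; apply/esym/(right_end _ y) => //.
  rewrite leNgt; apply/negP => /(sep _ (map_f _ b'D)).
  by have := copy_around Q0 Eb'; lra.
(* Inside the copy ending at p, zoom in further on its own maximum. *)
move=> e e0.
have [k ke] : exists k, q ^+ k < Num.min eps e / 2.
  by apply: expr_eventually_lt; rewrite ?divr_gt0 // lt_min eps0.
have k0 : 0 < q ^+ k by rewrite exprn_gt0.
have kE : 2 * q ^+ k < eps /\ 2 * q ^+ k < e.
  by apply/andP; rewrite -lt_min; lra.
have xE x : Q * q ^+ k * x + (b + Q * (1 - q ^+ k)) =
    p - Q * (q ^+ k * (1 - x)).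
  by rewrite -bQp; ring.
have dist x : -1 <= x <= 1 -> 0 <= Q * (q ^+ k * (1 - x)) <= 2 * q ^+ k.
  move=> x1.
  have h : 0 <= q ^+ k * (1 - x) by rewrite mulr_ge0 ?(ltW k0) //; lra.
  rewrite mulr_ge0 ?(ltW Q0) //=.
  have : q ^+ k * (1 - x) <= q ^+ k * 2 by rewrite ler_pM2l //; lra.
  have : Q * (q ^+ k * (1 - x)) <= 1 * (q ^+ k * (1 - x)) by rewrite ler_wpM2r.
  by lra.
exists (Q * q ^+ k), (b + Q * (1 - q ^+ k)); split.
- by rewrite mulr_gt0.
- move=> x /dist dx; rewrite xE addrAC subrr add0r normrN ger0_norm; lra.
- move=> x x1; rewrite xE local; last by have := dist _ x1; lra.
  rewrite (_ : (_ - _ - b) / Q = 1 - q ^+ k * (1 - x)); first exact: top_copy.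
  by rewrite -bQp; field; rewrite gt_eqF.
Qed.

Let top_gap x : g < x < 1 - 2 * q -> ~ E x.
Proof.
move=> /andP[gx xq] /ssE[d dD /(copy_around q0)/andP[dx1 dx2]].
by case: (sepD dD) => dE; move: dx1 dx2; rewrite ?dE; lra.
Qed.

(** The reflection [x |-> - x] preserves [E] and exchanges the two ends of a
    gap, which reduces suprema to infima. *)
Let small_copies_gap G : is_gap E G -> forall p, p = inf G \/ p = sup G ->
  small_copies_at E p.
Proof.
have inf_case G' : is_gap E G' -> small_copies_at E (inf G').
  move=> gG; have [Ep [r pr nE]] := gap_inf closedE gG.
  exact: small_copies_right nE.
move=> gG p [->|->]; first exact: inf_case.
have EN2 x : E x <-> E (- x) by split=> /EN //; rewrite opprK.
have NN (A : set R) : [set - x | x in [set - x | x in A]] = A.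
  rewrite image_comp (_ : _ \o _ = id) ?image_id //.
  by apply/funext => x /=; rewrite opprK.
rewrite -(NN G) -[sup _]opprK; apply: small_copiesN => //; apply: inf_case.
case: gG => [[x nEx GE] bG]; split.
  exists (- x); first by rewrite /= -EN2.
  rewrite GE; apply/seteqP; split=> [_ [y Gy <-]|y Gy].
    apply/component_realP => z zxy; rewrite /setC /= EN2.
    move/component_realP: Gy; apply; move: zxy.
    by rewrite !ge_min !le_max => /andP[/orP[]? /orP[]?]; lra.
  exists (- y); last by rewrite opprK.
  apply/component_realP => z zxy; rewrite /setC /= EN2.
  move/component_realP: Gy; apply; move: zxy.
  by rewrite !ge_min !le_max => /andP[/orP[]? /orP[]?]; lra.
have [M M0 GM] := ex_strict_bound_gt0 bG.
exists M; split; first exact: num_real.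
by move=> M' MM' _ [y /GM /= yM <-]; rewrite normrN ltW // (lt_trans yM).
Qed.

(** The gap [(g, 1 - 2 q)] below the top copy and its mirror image isolate
    [[-c, c]]: their midpoints [m] and [- m] are outside [E], so the component
    of [[-c, c]] stays inside the window [[-1, 1]]. *)
Lemma self_similar_cantorval : is_cantorval E.
Proof.
have m_notE : ~ E ((g + (1 - 2 * q)) / 2) by apply: top_gap; move: gq; lra.
set m := (g + (1 - 2 * q)) / 2 in m_notE.
have Eg' : E (1 - 2 * q).
  rewrite (_ : 1 - 2 * q = 1 - q * (1 - -1)); last by ring.
  by apply/top_copy1 => //; lra.
have cm : c < m.
  rewrite ltNge; apply/negP => mc; apply/m_notE/Ec.
  by rewrite /m in mc *; move: gq g0 c0; lra.
have gap_at k :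
    is_gap E `](1 - q ^+ k * (1 - g)), (1 - q ^+ k * (2 * q))[%classic.
  have k0 : 0 < q ^+ k by rewrite exprn_gt0.
  apply: gap_of_itv.
  - by rewrite ltrD2l ltrN2 ltr_pM2l //; move: gq; lra.
  - by apply/top_copy => //; move: gq q0 g0; lra.
  - rewrite (_ : 2 * q = 1 - (1 - 2 * q)); last by ring.
    by apply/top_copy => //; move: gq q0 g0; lra.
  - move=> x /andP[gx xq].
    have -> : x = 1 - q ^+ k * (1 - (1 - (1 - x) / q ^+ k)).
      by field; rewrite gt_eqF.
    have x'_gap : g < 1 - (1 - x) / q ^+ k < 1 - 2 * q.
      rewrite ltrBrDr addrC -ltrBrDr ltrD2l ltrN2 ltr_pdivrMr // ltr_pdivlMr //.
      by apply/andP; split; lra.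
    by rewrite top_copy; [exact: top_gap|move: x'_gap g0 q0; lra].
split.
- split=> //; apply/seteqP; split=> p.
    move=> lp; apply: contrapT => /(closed_avoid closedE)[e e0 eE].
    have [y [_ Ey /= ye]] := lp _ (nbhsx_ballx p e e0).
    by apply: eE Ey; rewrite -ball_normE in ye.
  move=> Ep U /nbhs_ballP[e /= e0 eU].
  have [n ne] : exists n, q ^+ n < e / 2.
    by apply: expr_eventually_lt; [exact: q01|lra].
  have [Dn ssn] := self_similar_iter n q0 ssE.
  have Q0 : 0 < q ^+ n by rewrite exprn_gt0.
  have /ssn[b bD /(copy_around Q0) pb] := Ep.
  have [Er El] := ends_in_E Q0 ssn bD.
  have near y : b - q ^+ n <= y <= b + q ^+ n -> U y.
    by move=> yb; apply: eU; rewrite -ball_normE /= ltr_norml; lra.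
  have [pE|pl] := eqVneq (b - q ^+ n) p; last first.
    by exists (b - q ^+ n); split => //; apply: near; lra.
  exists (b + q ^+ n); split=> //; last by apply: near; lra.
  by rewrite -pE gt_eqF //; lra.
(* The gaps of the small copies at 1 have right ends converging to 1 from
   below, which finitely many values cannot do. *)
- move=> /(finite_image (fun G : set R => sup G)) /finite_seqP[s sE].
  have [e e0 es] := seq_below_separated s 1.
  have [k ke] : exists k, q ^+ k < e / 2.
    by apply: expr_eventually_lt; [exact: q01|lra].
  have k0 : 0 < q ^+ k by rewrite exprn_gt0.
  have kq : 0 < q ^+ k * (2 * q) < q ^+ k * 2.
    by rewrite ltr_pM2l // mulr_gt0 //=; case/andP: q01; lra.
  have : 1 - q ^+ k * (2 * q) \in s.
    suff : [set` s] (1 - q ^+ k * (2 * q)) by [].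
    rewrite -sE; exists `](1 - q ^+ k * (1 - g)), (1 - q ^+ k * (2 * q))[%classic
      => //.
    rewrite sup_itv // bnd_simp ltrD2l ltrN2 ltr_pM2l //; move: gq; lra.
  by move=> /es; move: kq ke; lra.
- move=> G gG p pG; have cp := small_copies_gap gG pG.
  apply: (@accumulation_of_copies _ E p g (1 - 2 * q) (- m) (- c) c m) => //.
  all: try by rewrite /m in cm *; move: gq g0 c0 q0; lra.
  by move=> /EN; rewrite opprK.
Qed.

End SelfSimilarCantorval.

(** Expanding [x] for [n] steps with digits given by the cover, and then
    replacing the unknown remainder by [1], gives a point of [E] at distance at
    most [(c + 1) q^n] from [x]. *)
Lemma interval_in_self_similar (R : realType) (q c : R) (D : seq R)
    (E : set R) :
  0 < q < 1 -> 0 < c -> closed E -> self_similar q D E -> E 1 ->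
  (forall x : R, - c <= x <= c -> exists2 d, d \in D & `|x - d| <= q * c) ->
  forall x : R, - c <= x <= c -> E x.
Proof.
move=> q01 c0 closedE ssE E1 cover.
have q0 : 0 < q by case/andP: q01.
have approx n : forall x : R, - c <= x <= c ->
    exists2 y, E y & `|x - y| <= (c + 1) * q ^+ n.
  elim: n => [|n IH] x xc.
    by exists 1 => //; rewrite expr0 mulr1 ler_norml; lra.
  have [d dD xd] := cover x xc.
  have [|y Ey xy] := IH ((x - d) / q).
    move: xd; rewrite ler_norml ler_pdivlMr // ler_pdivrMr //.
    by move=> /andP[? ?]; apply/andP; split; lra.
  exists (d + q * y).
    apply/ssE; exists d => //.
    by rewrite (_ : (d + q * y - d) / q = y) //; field; rewrite gt_eqF.
  have -> : x - (d + q * y) = q * ((x - d) / q - y) by field; rewrite gt_eqF.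
  by rewrite normrM gtr0_norm // exprS mulrCA ler_pM2l.
move=> x xc; apply: contrapT => /(closed_avoid closedE)[e e0 eE].
have [n ne] : exists n, q ^+ n < e / (c + 1).
  by apply: expr_eventually_lt => //; rewrite divr_gt0 //; lra.
have [y Ey xy] := approx n x xc; apply: (eE y) => //.
apply: le_lt_trans xy _; move: ne; rewrite ltr_pdivlMr; last by lra.
by rewrite mulrC.
Qed.

(** * The central Cantor set and its difference set *)

Lemma eq_cantor_itv (R : realType) (a : nat -> R) (n : nat) (t t' : seq bool) :
  (forall i, (i < n)%N -> nth false t i = nth false t' i) ->
  cantor_itv a n t = cantor_itv a n t'.
Proof.
elim: n => [//|n IHn] tt' /=; rewrite tt' // IHn // => i ni.
by rewrite tt' // ltnW.
Qed.

(** Only the first [n] letters of a word matter at level [n], so words of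
    unspecified length can be used; this avoids casts between tuple types. *)
Lemma central_cantorP (R : realType) (a : nat -> R) (x : R) :
  central_cantor a x <-> forall n, exists t,
    (cantor_itv a n t).1 <= x <= (cantor_itv a n t).2.
Proof.
split=> [Cx n|Cx n _]; first by have [t _ xt] := Cx n I; exists t.
have [t xt] := Cx n; exists [tuple of mkseq (nth false t) n] => //=.
rewrite (@eq_cantor_itv _ _ _ _ t) // => i ni.
by rewrite nth_mkseq.
Qed.

Section CentralCantor.

Variables (R : realType) (a : nat -> R).
Hypothesis (a01 : forall n, 0 < a n < 1).

Lemma cantor_itv_le n t : (cantor_itv a n t).1 <= (cantor_itv a n t).2.
Proof.
elim: n => [|n IHn] /=; first exact: ler01.
case/andP: (a01 n) => an0 an1; move: IHn; set I := cantor_itv a n t => I12.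
have : 0 <= a n * (I.2 - I.1) by rewrite mulr_ge0 //; lra.
have : a n * (I.2 - I.1) <= 1 * (I.2 - I.1) by rewrite ler_wpM2r //; lra.
by rewrite /child; case: nth => /=; lra.
Qed.

Lemma cantor_itv_nested n t x :
  (cantor_itv a n.+1 t).1 <= x <= (cantor_itv a n.+1 t).2 ->
  (cantor_itv a n t).1 <= x <= (cantor_itv a n t).2.
Proof.
case/andP: (a01 n) => an0 an1 /=.
have := cantor_itv_le n t; set I := cantor_itv a n t => I12.
have : 0 <= a n * (I.2 - I.1) by rewrite mulr_ge0 //; lra.
by rewrite /child; case: nth => /=; lra.
Qed.

Lemma cantor_itv_01 n t x :
  (cantor_itv a n t).1 <= x <= (cantor_itv a n t).2 -> 0 <= x <= 1.
Proof. by elim: n => [//|n IHn] /cantor_itv_nested. Qed.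

Lemma central_cantor0 : central_cantor a 0.
Proof.
apply/central_cantorP => n; exists [::].
have := cantor_itv_le n [::].
suff -> : (cantor_itv a n [::]).1 = 0 by move=> ->; rewrite lexx.
by elim: n => [//|n IHn] /=; rewrite nth_nil.
Qed.

Lemma central_cantor1 : central_cantor a 1.
Proof.
apply/central_cantorP => n; exists (nseq n true).
have := cantor_itv_le n (nseq n true).
suff -> : (cantor_itv a n (nseq n true)).2 = 1 by move=> ->; rewrite lexx.
suff H m : (m <= n)%N -> (cantor_itv a m (nseq n true)).2 = 1 by exact: H.
by elim: m => [//|m IHm] mn /=; rewrite nth_nseq mn /=; apply/IHm/ltnW.
Qed.

Lemma compact_central_cantor : compact (central_cantor a).
Proof.
apply: (subclosed_compact _ (@segment_compact R 0 1)); last first.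
  by move=> x /central_cantorP/(_ 0%N)[t] /=; rewrite in_itv.
apply: closed_bigI => n _; apply: closed_bigcup => [|t _].
  exact: finite_finset.
rewrite (_ : mkset _ = `[(cantor_itv a n t).1, (cantor_itv a n t).2]%classic).
  exact: interval_closed.
by apply/seteqP; split=> x /=; rewrite in_itv.
Qed.

Lemma closed_difference :
  closed (set_difference (central_cantor a) (central_cantor a)).
Proof.
set C := central_cantor a.
rewrite (_ : set_difference C C = (fun z : R * R => z.1 - z.2) @` (C `*` C)).
  apply: compact_closed; first exact: Rhausdorff.
  apply: continuous_compact; last first.
    by apply: compact_setX; exact: compact_central_cantor.
  apply: continuous_subspaceT => z.
  by apply: cvgB; [exact: cvg_fst|exact: cvg_snd].
apply/seteqP; split=> [_ [x Cx [y Cy <-]]|_ [[x y] [Cx Cy] <-]].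
  by exists (x, y).
by exists x => //; exists y.
Qed.

End CentralCantor.

(** * The alternating sequence *)

Lemma child_affine (R : realType) (r q d : R) (b : bool) (I : R * R) :
  child r b (q * I.1 + d, q * I.2 + d) =
  (q * (child r b I).1 + d, q * (child r b I).2 + d).
Proof. by rewrite /child; case: b => /=; congr pair; field. Qed.

Section AlternatingCantor.

Variables (R : realType) (a1 a2 : R).
Hypotheses (ha1 : 0 < a1 < 1) (ha2 : 0 < a2 < 1).

Let a := alternating_seq a1 a2.
Let q := (1 - a1) * (1 - a2) / 4.
Let t1 := (1 + a1) / 2.
Let t2 := (1 - a1) * (1 + a2) / 4.
Let tau (b1 b2 : bool) := b1%:R * t1 + b2%:R * t2.
Let C := central_cantor a.
Let signs : seq R := [:: -1; 0; 1].

Lemma alternating_seq01 n : 0 < alternating_seq a1 a2 n < 1.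
Proof. by rewrite /alternating_seq; case: odd. Qed.

(** The sequence has period two, so prepending two letters to a word applies the
    similarity [x |-> q x + tau b1 b2] to its interval. *)
Lemma cantor_itv_cons2 n (b1 b2 : bool) (t : seq bool) :
  cantor_itv a n.+2 [:: b1, b2 & t] =
  (q * (cantor_itv a n t).1 + tau b1 b2, q * (cantor_itv a n t).2 + tau b1 b2).
Proof.
elim: n => [|n IHn].
  by rewrite /= /child /a /alternating_seq /= /tau /t1 /t2 /q;
    case: b1; case: b2 => /=; congr pair; field.
rewrite [LHS]/= -[child (a n.+1) _ _]/(cantor_itv a n.+2 [:: b1, b2 & t]) IHn.
rewrite (_ : a n.+2 = a n); last by rewrite /a /alternating_seq /= negbK.
by rewrite child_affine.
Qed.

(** The four translates of [[0, q]] by [0], [t2], [t1] and [t1 + t2] are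
    disjoint. *)
Lemma ratio_lt_digits : [/\ 0 < q, q < 1, q < t2 & q < t1 - t2].
Proof.
case/andP: ha1 => ? ?; case/andP: ha2 => ? ?.
have h : 0 < (1 - a1) * (1 - a2) by rewrite mulr_gt0; lra.
have h1 : (1 - a1) * (1 - a2) < 1 * 1 by rewrite ltr_pM //; lra.
have h2 : 0 < (1 - a1) * a2 by rewrite mulr_gt0; lra.
by rewrite /q /t1 /t2; split; lra.
Qed.

(** For the direct inclusion, the first two letters of the words locating [x]
    might a priori depend on the level; the disjointness of the four intervals
    of level two rules this out. *)
Lemma central_cantor_split x :
  C x <-> exists b1 b2 : bool, C ((x - tau b1 b2) / q).
Proof.
have [q0 q1 qt2 qt1] := ratio_lt_digits.
have in_copy n b1 b2 t :
    (cantor_itv a n.+2 [:: b1, b2 & t]).1 <= x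
      <= (cantor_itv a n.+2 [:: b1, b2 & t]).2 <->
    (cantor_itv a n t).1 <= (x - tau b1 b2) / q <= (cantor_itv a n t).2.
  rewrite cantor_itv_cons2 /= ler_pdivlMr // ler_pdivrMr //.
  by split=> /andP[? ?]; apply/andP; split; lra.
have cons2 n t : cantor_itv a n.+2 t =
    cantor_itv a n.+2 [:: nth false t 0, nth false t 1 & drop 2 t].
  by apply: eq_cantor_itv => -[|[|i]] //= _; rewrite nth_drop.
split=> [/central_cantorP Cx | [b1 [b2 /central_cantorP Cy]]].
  have [t0] := Cx 2%N; rewrite cons2 in_copy.
  set b1 := nth _ _ 0; set b2 := nth _ _ 1 => xb; exists b1, b2.
  apply/central_cantorP => n; have [t] := Cx n.+2; rewrite cons2 in_copy => xt.
  exists (drop 2 t).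
  suff -> : tau b1 b2 = tau (nth false t 0) (nth false t 1) by [].
  move: xt => /(cantor_itv_01 alternating_seq01).
  move: xb => /(cantor_itv_01 alternating_seq01).
  rewrite !ler_pdivlMr // !ler_pdivrMr // /tau.
  move: b1 b2 (nth false t 0) (nth false t 1) => [] [] [] [] //=;
    rewrite ?mul0r ?mul1r => /andP[? ?] /andP[? ?]; exfalso; lra.
apply/central_cantorP => n; have [t /in_copy yt] := Cy n.
exists [:: b1, b2 & t].
by apply: (cantor_itv_nested alternating_seq01);
   exact: (cantor_itv_nested alternating_seq01).
Qed.

Let E := set_difference C C.
Let D := [seq i * t1 + j * t2 | i <- signs, j <- signs].

Lemma difference_self_similar : self_similar q D E.
Proof.
have [q0 q1 qt2 qt1] := ratio_lt_digits.
have signP (b b' : bool) : b%:R - b'%:R \in signs.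
  by move: b b' => [] [] /=;
    rewrite ?mulr1n ?mulr0n !inE ?subrr ?subr0 ?sub0r ?eqxx ?orbT.
have sign_bool i : i \in signs -> exists b b' : bool, i = b%:R - b'%:R.
  rewrite !inE => /or3P[] /eqP ->.
  - by exists false, true; rewrite sub0r.
  - by exists false, false; rewrite subrr.
  - by exists true, false; rewrite subr0.
move=> x; split.
  move=> [c /central_cantor_split[b1 [b2 Cc]]].
  move=> [c' /central_cantor_split[b1' [b2' Cc']] <-].
  exists ((b1%:R - b1'%:R) * t1 + (b2%:R - b2'%:R) * t2).
    apply/allpairsP; exists (b1%:R - b1'%:R, b2%:R - b2'%:R).
    by rewrite !signP.
  exists ((c - tau b1 b2) / q) => //; exists ((c' - tau b1' b2') / q) => //.
  by rewrite /tau; field; rewrite gt_eqF.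
move=> [_ /allpairsP[[i j] /=
  [/sign_bool[b1 [b1' ->]] /sign_bool[b2 [b2' ->]] ->]]].
move=> [y Cy [y' Cy' yy']].
exists (q * y + tau b1 b2).
  apply/central_cantor_split; exists b1, b2.
  by rewrite addrK mulrAC divff ?mul1r // gt_eqF.
exists (q * y' + tau b1' b2').
  apply/central_cantor_split; exists b1', b2'.
  by rewrite addrK mulrAC divff ?mul1r // gt_eqF.
have -> : q * y + tau b1 b2 - (q * y' + tau b1' b2') =
  q * (y - y') + (tau b1 b2 - tau b1' b2') by ring.
by rewrite yy' /tau; field; rewrite gt_eqF.
Qed.

(** The last two hypotheses bound the spacings [t1 - t2] and [2 t2 - t1] of the
    digits other than [t1 + t2] and [- (t1 + t2)] by [2 q c], where
    [c = t1 / (1 - q)] solves [c = t1 + q c]: seven copies of [[-c, c]] then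
    cover it. *)
Lemma difference_is_cantorval :
  1 / 3 < a2 ->
  (t1 - t2) * (1 - q) <= 2 * q * t1 ->
  (2 * t2 - t1) * (1 - q) <= 2 * q * t1 ->
  is_cantorval E.
Proof.
move=> a2_gt condA condB.
have [q0 q1 qt2 qt1] := ratio_lt_digits.
have q01 : 0 < q < 1 by rewrite q0.
have t1_gt0 : 0 < t1 by lra.
have q1E : 1 - q = t1 + t2 by rewrite /q /t1 /t2; field.
have t2_gt : 2 * q < t2.
  have : 0 < (1 - a1) * (3 * a2 - 1).
    by rewrite mulr_gt0 //; [case/andP: ha1|]; lra.
  by rewrite /q /t2; lra.
have memD i j : i \in signs -> j \in signs -> i * t1 + j * t2 \in D.
  by move=> iS jS; apply/allpairsP; exists (i, j).
have C1 : C 1 by exact: central_cantor1 alternating_seq01.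
have C0 : C 0 by exact: central_cantor0 alternating_seq01.
have C01 x : C x -> 0 <= x <= 1.
  by move=> /central_cantorP/(_ 0%N)[].
have E1 : E 1 by exists 1 => //; exists 0; rewrite ?subr0.
have closedE : closed E by apply: closed_difference; exact: alternating_seq01.
set c := t1 / (1 - q).
have c_gt0 : 0 < c by rewrite divr_gt0 // subr_gt0.
have cE : c = t1 + q * c by rewrite /c; field; rewrite subr_eq0 gt_eqF.
have qcE : 2 * (q * c) * (1 - q) = 2 * q * t1.
  by rewrite /c; field; rewrite subr_eq0 gt_eqF.
have gapA : t1 - t2 <= 2 * (q * c).
  by rewrite -(@ler_pM2r _ (1 - q)) ?subr_gt0 // qcE.
have gapB : 2 * t2 - t1 <= 2 * (q * c).
  by rewrite -(@ler_pM2r _ (1 - q)) ?subr_gt0 // qcE.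
apply: (@self_similar_cantorval R q (t1 + q) c D E) => //.
- exact: difference_self_similar.
- by move=> _ [x Cx [y Cy <-]]; exists y => //; exists x => //; rewrite opprB.
- by move=> _ [x /C01 x01 [y /C01 y01 <-]]; lra.
- by rewrite q1E -[t1]mul1r -[t2]mul1r memD // !inE eqxx !orbT.
- move=> _ /allpairsP[[i j] /= [+ + ->]].
  rewrite !inE => /or3P[] /eqP -> /or3P[] /eqP ->;
    first [by left; lra | by right; lra].
- by lra.
- by lra.
- apply/difference_self_similar; exists t1.
    by rewrite -[t1]addr0 -[t1]mul1r -(mul0r t2) memD // !inE eqxx ?orbT.
  by rewrite (_ : (t1 + q - t1) / q = 1) //; field; rewrite gt_eqF.
apply: (interval_in_self_similar q01 c_gt0 closedE difference_self_similar E1).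
move=> x xc.
have pick i j : i \in signs -> j \in signs ->
    - (q * c) <= x - (i * t1 + j * t2) <= q * c ->
    exists2 d, d \in D & `|x - d| <= q * c.
  by move=> iS jS xd; exists (i * t1 + j * t2); [exact: memD|rewrite ler_norml].
have [m1 m0 p1] : [/\ -1 \in signs, 0 \in signs & 1 \in signs].
  by rewrite !inE !eqxx !orbT.
(* The seven digits, in increasing order when 2 t2 >= t1. *)
have [?|?] := lerP x (- t1 + q * c); first by apply: (pick (-1) 0) => //; lra.
have [?|?] := lerP x (- t2 + q * c); first by apply: (pick 0 (-1)) => //; lra.
have [?|?] := lerP x (t2 - t1 + q * c).
  by apply: (pick (-1) 1) => //; lra.
have [?|?] := lerP x (q * c); first by apply: (pick 0 0) => //; lra.
have [?|?] := lerP x (t1 - t2 + q * c).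
  by apply: (pick 1 (-1)) => //; lra.
have [?|?] := lerP x (t2 + q * c); first by apply: (pick 0 1) => //; lra.
by apply: (pick 1 0) => //; lra.
Qed.

End AlternatingCantor.

(** Let [PA] and [PB] be the two quadratics in [u].  Since
    [PB - PA = (1 + a) (7 (u + a) - 3)], they agree at [u' = 3/7 - a], where
    their common value is [(16/49) (1 - 35 a)].  [PB] increases on
    [u >= 0], and [PA] decreases on [u <= 1 + 3 a], which contains [u'].  If
    [a <= 1/35], then [PB u <= 0 <= PB u'] gives [u <= u'], whence
    [PA u >= PA u' = PB u' >= 0].  If [a > 1/35], then [PA u >= 0 > PA u'] gives
    [u <= u'], whence [PB u <= PB u' = PA u' < 0]. *)
Lemma cover_conditions (R : realType) (a u : R) :
  0 < a < 1 -> 0 <= u ->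
  (a <= 1 / 35 /\ u ^+ 2 + (5 + a) * u - 2 - 6 * a <= 0) \/
  (1 / 35 < a /\ u <= 1 + 3 * a /\
     0 <= u ^+ 2 - (2 + 6 * a) * u + 1 - 10 * a - 7 * a ^+ 2) ->
  0 <= u ^+ 2 - (2 + 6 * a) * u + 1 - 10 * a - 7 * a ^+ 2 /\
  u ^+ 2 + (5 + a) * u - 2 - 6 * a <= 0.
Proof.
move=> a01 u0 [[a35 PB]|[a35 [u_le PA]]]; split=> //.
- have us : u <= 3 / 7 - a by nra.
  nra.
- have us : u <= 3 / 7 - a by nra.
  nra.
Qed.

Lemma sqrt_root (R : realType) (y : R) : 0 <= y ->
  exists s : R, [/\ 0 <= s, s ^+ 2 = y & Num.sqrt y = s].
Proof. by move=> y0; exists (Num.sqrt y); rewrite sqrtr_ge0 sqr_sqrtr. Qed.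

Theorem corollary3p2 (R : realType) (a1 a2 : R)
  (ha1 : 0 < a1 < 1) (ha2 : 0 < a2 < 1)
  (ha1_lt : a1 < 1 / 3) (ha2_gt : 1 / 3 < a2)
  (h : (a1 <= 1 / 35 /\
        a2 <= (- a1 - 5 + Num.sqrt (a1 ^+ 2 + 34 * a1 + 33)) / (2 - 2 * a1))
       \/
       ((1 / 35 < a1 < (6 * Num.sqrt 5 - 13) / 11) /\
        a2 <= (3 * a1 + 1 - 4 * Num.sqrt (a1 ^+ 2 + a1)) / (1 - a1))) :
  is_cantorval
    (set_difference (central_cantor (alternating_seq a1 a2))
                    (central_cantor (alternating_seq a1 a2))).
Proof.
case/andP: (ha1) => a1_gt0 a1_lt1; case/andP: (ha2) => a2_gt0 a2_lt1.
have [PA PB] :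
    0 <= ((1 - a1) * a2) ^+ 2 - (2 + 6 * a1) * ((1 - a1) * a2)
         + 1 - 10 * a1 - 7 * a1 ^+ 2 /\
    ((1 - a1) * a2) ^+ 2 + (5 + a1) * ((1 - a1) * a2) - 2 - 6 * a1 <= 0.
  have u0 : 0 <= (1 - a1) * a2 by rewrite mulr_ge0 //; lra.
  apply: cover_conditions => //.
  case: h => [[a35]|[/andP[a35 _]]];
    (rewrite ler_pdivlMr; last by lra) => a2_le.
  - have [|s [s0 sE sD]] := @sqrt_root R (a1 ^+ 2 + 34 * a1 + 33); first by nra.
    rewrite sD in a2_le.
    left; split=> //.
    have : (2 * ((1 - a1) * a2) + (5 + a1)) ^+ 2 <= s ^+ 2.
      by rewrite lerXn2r ?nnegrE //; lra.
    by rewrite sE; lra.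
  - have [|s [s0 sE sD]] := @sqrt_root R (a1 ^+ 2 + a1); first by nra.
    rewrite sD in a2_le.
    right; split=> //; split; first by lra.
    have : (4 * s) ^+ 2 <= (1 + 3 * a1 - (1 - a1) * a2) ^+ 2.
      by rewrite lerXn2r ?nnegrE //; lra.
    by rewrite exprMn sE; lra.
apply: difference_is_cantorval => //; lra.
Qed.
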